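(* Assume that the bounded bilinear form $b:Y\times V\to\mathbb{R}$ satisfies the following: there is a constant $C_b>0$ with $$C_b\|y\|_Y\le \sup_{0\ne v\in V}\frac{b(y,v)}{\|v\|_V}\quad\forall y\in Y,\qquad\text{and}\qquad \{v\in V: b(y,v)=0\ \text{for all } y\in Y\}=\{0\}.$$ Assume also that $\Pi:V\to V_h$ is a Fortin operator. Let $(\bar{\mathsf y},\bar{\mathsf u})\in Y\times U_{ad}$ be the unique solution of the continuous optimal control problem and $(\bar{\mathsf y}_h,\bar{\mathsf u}_h)\in Y_h\times U_{ad,h}$ the unique solution of the discrete optimal control problem, and let $(\bar\lambda,\bar{\mathsf p})\in Y\times V$ and $(\bar\lambda_h,\bar{\mathsf p}_h)\in Y_h\times V_h$ be the corresponding optimal adjoint state and discrete optimal adjoint state (all defined in the context). Then $$\alpha^2\|\bar{\mathsf u}-\bar{\mathsf u}_h\|_U^2\lesssim \alpha\inf_{\mathsf u_h\in U_{ad,h}}(\mathcal I_{U'}^{U}D^*\bar{\mathsf p}_h+\alpha\bar{\mathsf u}_h,\mathsf u_h-\bar{\mathsf u})_U+\inf_{w_h\in Y_h}\|\bar{\mathsf y}-w_h\|_Y^2+\inf_{v_h\in V_h}\|\bar{\mathsf p}-v_h\|_V^2+\inf_{w_h\in Y_h}\|\bar\lambda-w_h\|_Y^2,$$ $$\|\bar{\mathsf y}-\bar{\mathsf y}_h\|_Y^2\lesssim\inf_{w_h\in Y_h}\|\bar{\mathsf y}-w_h\|_Y^2+\|\bar{\mathsf u}-\bar{\mathsf u}_h\|_U^2,$$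 and $$\|\bar{\mathsf p}-\bar{\mathsf p}_h\|_V^2\lesssim\inf_{v_h\in V_h}\|\bar{\mathsf p}-v_h\|_V^2+\inf_{w_h\in Y_h}\|\bar\lambda-w_h\|_Y^2+\inf_{w_h\in Y_h}\|\bar{\mathsf y}-w_h\|_Y^2+\|\bar{\mathsf u}-\bar{\mathsf u}_h\|_U^2 .$$
   Context: $U,Y,V,\mathcal Y$ are real Hilbert spaces; $U_{ad}\subseteq U$ is non-empty, bounded, closed and convex; $b:Y\times V\to\mathbb{R}$ is a bounded bilinear form; $O:Y\to\mathcal Y$ and $D:U\to V'$ are bounded linear operators; $\mathsf y_d\in\mathcal Y$ and $\alpha>0$ are given. The cost functional is $J(\mathsf y,\mathsf u):=\tfrac12\|O\mathsf y-\mathsf y_d\|_{\mathcal Y}^2+\tfrac{\alpha}{2}\|\mathsf u\|_U^2$. For a bounded linear operator $T$, $T^*$ is its dual; biduals are identified with the original Hilbert spaces, so $D^*:V\to U'$. $\mathcal I_{X}^{X'}:X\to X'$ is the canonical (Riesz) isomorphism, and $\mathcal I_{X'}^{X}$ is its inverse. Continuous problem: minimize $J(\mathsf y,\mathsf u)$ over $(\mathsf y,\mathsf u)\in Y\times U_{ad}$ subject to $b(\mathsf y,v)=\langle D\mathsf u,v\rangle_{V',V}$ for all $v\in V$. The optimal adjoint state $(\bar\lambda,\bar{\mathsf p})\in Y\times V$ is the unique solution of $$(\bar{\mathsf p},v)_V-b(\bar\lambda,v)=0,\quad b(w,\bar{\mathsf p})=\langle O^*\mathcal I_{\mathcal Y}^{\mathcal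 Y'}(O\bar{\mathsf y}-\mathsf y_d),w\rangle_{Y',Y}\quad\forall(v,w)\in V\times Y.$$ Discretization: $V_h\subseteq V$ and $Y_h\subseteq Y$ are finite-dimensional subspaces, and $U_h\subseteq U$ is a (not necessarily discrete) subspace with $U_{ad,h}:=U_h\cap U_{ad}\neq\emptyset$; the choice $U_h=U$ is allowed. The operator $\Theta_h:Y\to V_h$ is defined by $(\Theta_h\mathsf y,v_h)_V=b(\mathsf y,v_h)$ for all $v_h\in V_h$, and $V_h^{\Theta_h}:=\Theta_h(Y_h)$. A map $\Pi:V\to V_h$ is a Fortin operator if there is $C_\Pi>0$ such that $\|\Pi v\|_V\le C_\Pi\|v\|_V$ and $b(\mathsf y_h,v-\Pi v)=0$ for all $\mathsf y_h\in Y_h$, $v\in V$. Discrete problem: minimize $J(\mathsf y_h,\mathsf u_h)$ over $(\mathsf y_h,\mathsf u_h)\in Y_h\times U_{ad,h}$ subject to $b(\mathsf y_h,v_h)=\langle D\mathsf u_h,v_h\rangle_{V',V}$ for all $v_h\in V_h^{\Theta_h}$. The discrete optimal adjoint state $(\bar\lambda_h,\bar{\mathsf p}_h)\in Y_h\times V_h$ is the unique solution of $$(\bar{\mathsf p}_h,v_h)_V-b(\bar\lambda_h,v_h)=0,\quad b(w_h,\bar{\mathsf p}_h)=\langle O^*\mathcal I_{\mathcal Y}^{\mathcal Y'}(O\bar{\mathsf y}_h-\mathsf y_d),w_h\rangle_{Y',Y}\quad\forall(v_h,w_h)\in V_h\times Y_h.$$ Notation: $A\lesssim R$ is the usual shorthand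 for $A\le C\,R$ with a generic constant $C>0$.
   Formalization: In the first estimate the term α·inf(…) carries its own generic constant, separate from the one multiplying the best-approximation terms, because the infimum can be negative and a single common constant makes the estimate false. *)

(* Defs.v *)
(* MathComp-Analysis *)
From HB Require Import structures.
From mathcomp Require Import all_boot all_order all_algebra.
From mathcomp Require Import all_classical all_reals all_analysis.

Set Implicit Arguments.
Unset Strict Implicit.
Unset Printing Implicit Defensive.

Import Order.TTheory GRing.Theory Num.Theory.
Import numFieldNormedType.Exports.
Local Open Scope classical_set_scope.
Local Open Scope ring_scope.

HB.mixin Record isHilbert (R : realType) H of CompleteNormedModule R H := {
  inner : {dot H for (@idfun R)} ;
  inner_sqr_norm : forall x : H, inner x x = `|x| ^+ 2
}.

#[short(type="hilbertType")]
HB.structure Definition Hilbert (R : realType) :=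
  {H of isHilbert R H & CompleteNormedModule R H}.

Section Hilbert_notions.
Context {R : realType}.
Implicit Types U V Y Z X : hilbertType R.

Definition bounded_operator X Z (f : X -> Z) : Prop :=
  linear f /\ exists M, forall x, `|f x| <= M * `|x|.

Definition bounded_functional X (f : X -> R) : Prop :=
  scalar f /\ exists M, forall x, `|f x| <= M * `|x|.

(* An operator D : U -> V' is a function with values in V -> R, D u v being
   the duality pairing <D u, v>. The last conjunct is the bound
   |D u|_{V'} <= M |u| with the dual norm written out. *)
Definition bounded_operator_to_dual U V (D : U -> V -> R) : Prop :=
  [/\ forall u, bounded_functional (D u),
      forall a u1 u2 v, D (a *: u1 + u2) v = a * D u1 v + D u2 v &
      exists M, forall u v, `|D u v| <= M * `|u| * `|v|].

Definition bounded_form Y V (b : Y -> V -> R) : Prop :=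
  exists M, forall y v, `|b y v| <= M * `|y| * `|v|.

Definition riesz X (x : X) : X -> R := fun z => inner x z.

Definition riesz_inv X (f : X -> R) : X := xget 0 [set x | riesz x = f].

Definition dual_op Y Z (O : Y -> Z) (f : Z -> R) : Y -> R := fun y => f (O y).

(* For D : U -> V', the dual V'' -> U' restricted to V along V = V''. *)
Definition dual_op_to_dual U V (D : U -> V -> R) (v : V) : U -> R :=
  fun u => D u v.

Definition linear_subspace X (S : set X) : Prop :=
  S 0 /\ forall (a : R) x y, S x -> S y -> S (a *: x + y).

Definition fin_dim_subspace X (S : set X) : Prop :=
  exists (n : nat) (e : 'I_n -> X),
    S = [set \sum_(i < n) c i *: e i | c in [set: 'I_n -> R]].

(* For a bounded form b the quotients are bounded above, and if V = {0} the
   supremum of the empty set is 0. *)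
Definition inf_sup Y V (b : Y -> V -> R) (Cb : R) : Prop :=
  forall y, Cb * `|y| <= sup [set b y v / `|v| | v in [set v | v != 0]].

Definition nondegenerate_test Y V (b : Y -> V -> R) : Prop :=
  [set v | forall y, b y v = 0] = [set 0].

Definition fortin Y V (b : Y -> V -> R) (Yh : set Y) (Vh : set V) (CPi : R)
    (Pi : V -> V) : Prop :=
  [/\ forall v, Vh (Pi v),
      forall v, `|Pi v| <= CPi * `|v| &
      forall yh v, Yh yh -> b yh (v - Pi v) = 0].

Definition Theta Y V (b : Y -> V -> R) (Vh : set V) (y : Y) : V :=
  xget 0 [set t | Vh t /\ forall vh, Vh vh -> inner t vh = b y vh].

Definition cost Y U Z (O : Y -> Z) (yd : Z) (alpha : R) (z : Y * U) : R :=
  2^-1 * `|O z.1 - yd| ^+ 2 + alpha / 2 * `|z.2| ^+ 2.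

(* The state lies in A, the control in K, and the state equation is tested
   with W. *)
Definition feasible Y V U (b : Y -> V -> R) (D : U -> V -> R)
    (A : set Y) (W : set V) (K : set U) : set (Y * U) :=
  [set z | [/\ A z.1, K z.2 & forall v, W v -> b z.1 v = D z.2 v]].

Definition minimizer (T : Type) (J : T -> R) (F : set T) (z : T) : Prop :=
  F z /\ forall z', F z' -> J z <= J z'.

Definition optimal_control Y V U Z (b : Y -> V -> R) (D : U -> V -> R)
    (O : Y -> Z) (yd : Z) (alpha : R) (Uad : set U) (y : Y) (u : U) : Prop :=
  minimizer (cost O yd alpha) (feasible b D setT setT Uad) (y, u).

Definition discrete_optimal_control Y V U Z (b : Y -> V -> R)
    (D : U -> V -> R) (O : Y -> Z) (yd : Z) (alpha : R) (Yh : set Y)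
    (Vh : set V) (Uadh : set U) (yh : Y) (uh : U) : Prop :=
  minimizer (cost O yd alpha) (feasible b D Yh (Theta b Vh @` Yh) Uadh)
    (yh, uh).

Definition adjoint_system Y V Z (b : Y -> V -> R) (O : Y -> Z) (yd : Z)
    (A : set Y) (B : set V) (y lam : Y) (p : V) : Prop :=
  [/\ A lam, B p,
      forall v, B v -> inner p v - b lam v = 0 &
      forall w, A w -> b w p = dual_op O (riesz (O y - yd)) w].

Definition optimal_adjoint Y V Z (b : Y -> V -> R) (O : Y -> Z) (yd : Z)
    (y lam : Y) (p : V) : Prop :=
  adjoint_system b O yd setT setT y lam p.

Definition discrete_optimal_adjoint Y V Z (b : Y -> V -> R) (O : Y -> Z)
    (yd : Z) (Yh : set Y) (Vh : set V) (yh lamh : Y) (ph : V) : Prop :=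
  adjoint_system b O yd Yh Vh yh lamh ph.

Definition best_approx_sq X (S : set X) (x : X) : R :=
  inf [set `|x - w| ^+ 2 | w in S].

End Hilbert_notions.

(* Main.v *)
Require Import Defs.
From HB Require Import structures.
From mathcomp Require Import all_boot all_order all_algebra.
From mathcomp Require Import all_classical all_reals all_analysis.
From mathcomp Require Import ring lra.
Import Order.TTheory GRing.Theory Num.Theory.
Import numFieldNormedType.Exports.
Local Open Scope classical_set_scope.
Local Open Scope ring_scope.

(* The control error is split with the discrete state [yhat] and adjoint [phat]
   belonging to the continuous optimal control [u]. Adding the two variational
   inequalities gives
     alpha |u - uh|^2 <= (D^* ph + alpha uh, wh - u) + D (u - uh) (ph - p),
   and [D (u - uh) (ph - phat) = - |O yhat - O yh|^2 <= 0], so only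
   [D (u - uh) (phat - p)] remains. Since [phat - p] does not involve [u - uh],
   Young's inequality makes the constants independent of alpha. The state and
   adjoint errors follow from the discrete inf-sup condition
   [|yh| <= CPi / Cb |Theta yh|], a consequence of the Fortin property. *)

(** * Hilbert spaces *)

Section inner_product.
Context {R : realType} {X : hilbertType R}.
Implicit Types x y z : X.

Lemma innerC x y : inner x y = inner y x.
Proof. by rewrite hermC /= expr0 mul1r. Qed.

Lemma innerPl k x y z : inner (k *: x + y) z = k * inner x z + inner y z.
Proof. by rewrite linearPl. Qed.

Lemma innerPr k x y z : inner z (k *: x + y) = k * inner z x + inner z y.
Proof. by rewrite innerC innerPl !(innerC z). Qed.

Lemma innerDl x y z : inner (x + y) z = inner x z + inner y z.
Proof. by rewrite linearDl. Qed.

Lemma innerZl k x y : inner (k *: x) y = k * inner x y.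
Proof. by rewrite linearZl_LR. Qed.

Lemma sqr_normD x y : `|x + y| ^+ 2 = `|x| ^+ 2 + 2 * inner x y + `|y| ^+ 2.
Proof.
rewrite -!inner_sqr_norm -[x in LHS](scale1r x) innerPl !(innerC _ (_ + y)).
by rewrite !innerPl (innerC y x); ring.
Qed.

(** Squaring the triangle inequality for [z + w] and cancelling the squares gives one side;
    replacing [x] by [- x] gives the other. *)
Lemma cauchy_schwarz x y : `|inner x y| <= `|x| * `|y|.
Proof.
have main z w : inner z w <= `|z| * `|w|.
  have : `|z + w| ^+ 2 <= (`|z| + `|w|) ^+ 2.
    by rewrite lerXn2r ?nnegrE ?addr_ge0 ?ler_normD.
  by rewrite sqr_normD sqrrD; lra.
rewrite ler_norml main andbT lerNl.
by rewrite -linearNl (le_trans (main _ _))// normrN.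
Qed.

End inner_product.

(** * Quadratic energies and the symmetric Lax-Milgram theorem *)

Section symmetric_forms.
Context {R : realType} {X : hilbertType R} (a : X -> X -> R).
Hypothesis a_linear : forall k x y z, a (k *: x + y) z = k * a x z + a y z.
Hypothesis aC : forall x y, a x y = a y x.

Lemma symmetric_formPr k x y z : a z (k *: x + y) = k * a z x + a z y.
Proof. by rewrite aC a_linear !(aC z). Qed.

Lemma energy_expand (f : X -> R) (t : R) x h : scalar f ->
  a (t *: h + x) (t *: h + x) - 2 * f (t *: h + x) =
  (a x x - 2 * f x) + 2 * t * (a x h - f h) + t ^+ 2 * a h h.
Proof.
by move=> fl; rewrite fl !a_linear !symmetric_formPr (aC h x) /=; ring.
Qed.

(** Bounds the Euler residual [g] of a near-minimiser by its energy gap [k]. The shift in [s + 1]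
    keeps the denominator positive when [s = 0]. *)
Lemma sqr_le_of_quadratic_ge0 (g s k : R) : 0 <= s ->
  (forall t, 0 <= k + 2 * t * g + t ^+ 2 * s) -> g ^+ 2 <= (s + 1) * k.
Proof.
move=> s0 /(_ (- g / (s + 1))) H.
have s1 : 0 < s + 1 by lra.
have : 0 <= k + 2 * (- g / (s + 1)) * g + (- g / (s + 1)) ^+ 2 * (s + 1).
  by apply: (le_trans H); rewrite lerD2l ler_wpM2l ?sqr_ge0 ?lerDl.
have -> : k + 2 * (- g / (s + 1)) * g + (- g / (s + 1)) ^+ 2 * (s + 1) =
  k - g ^+ 2 / (s + 1) by field; lra.
by rewrite subr_ge0 ler_pdivrMr// mulrC.
Qed.

(* A minimising sequence of the energy [a x x - 2 f x] is Cauchy by the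
   parallelogram identity, and its limit satisfies the Euler equation. *)
Lemma lax_milgram_symmetric (f : X -> R) (c M : R) :
  0 < c -> (forall x, c * `|x| ^+ 2 <= a x x) ->
  (forall x y, `|a x y| <= M * `|x| * `|y|) -> bounded_functional f ->
  exists x, forall h, a x h = f h.
Proof.
move=> c0 ac aM [fl [N fN]].
pose q x := a x x - 2 * f x.
have qE t x h : q (t *: h + x) = q x + 2 * t * (a x h - f h) + t ^+ 2 * a h h.
  exact: energy_expand.
have aa0 x : 0 <= a x x.
  by rewrite (le_trans _ (ac x))// mulr_ge0 ?sqr_ge0 ?(ltW c0).
(* The bound comes from completing the square in [c * |x| ^+ 2 - 2 * N * |x|]. *)
have q_lb : has_lbound (range q).
  exists (- (N ^+ 2 / c)) => _ [x _ <-]; rewrite /q.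
  have h1 : f x <= N * `|x| by rewrite (le_trans (ler_norm _)).
  have h2 := ac x.
  have h3 : 0 <= c^-1 * (c * `|x| - N) ^+ 2.
    by rewrite mulr_ge0 ?invr_ge0 ?sqr_ge0 ?(ltW c0).
  have h4 : c^-1 * (c * `|x| - N) ^+ 2 =
    c * `|x| ^+ 2 - 2 * (N * `|x|) + N ^+ 2 / c by field; lra.
  lra.
have q_inf : has_inf (range q) by split => //; exists (q 0); exists 0.
pose m := inf (range q).
have qm x : m <= q x by apply: ge_inf => //; exists x.
pose d (n : nat) : R := n.+1%:R^-1.
have d0 n : 0 < d n by rewrite invr_gt0.
have [u uP] : {u : nat -> X & forall n, q (u n) < m + d n}.
  apply: (@choice nat X (fun n x => q x < m + d n)) => n.
  by have [_ [x _ <-] ?] := inf_adherent (d0 n) q_inf; exists x.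
have half (x : X) : 2^-1 *: (x + x) = x.
  by rewrite -mulr2n -[x *+ 2]scaler_nat scalerA mulVf ?scale1r ?pnatr_eq0.
(* With midpoint [z] and half-difference [h], [q (u i) + q (u j) = 2 * q z + 2 * a h h], and [q z]
   is at least [m]. *)
have udist i j : c / 2 * `|u i - u j| ^+ 2 <= d i + d j.
  pose z := 2^-1 *: (u i + u j); pose h := 2^-1 *: (u i - u j).
  have Ei : u i = 1 *: h + z.
    by rewrite /z /h scale1r -scalerDr addrACA addNr addr0 half.
  have Ej : u j = (- 1) *: h + z.
    by rewrite /z /h scaleN1r -scalerN -scalerDr opprB addrA subrK half.
  have := uP i; have := uP j; rewrite {1}Ei {1}Ej !qE.
  have := qm z; have := ac h.
  have -> : `|h| ^+ 2 = 4^-1 * `|u i - u j| ^+ 2.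
    by rewrite normrZ exprMn ger0_norm//; congr (_ * _); field.
  lra.
have d_small (e : R) : 0 < e -> \forall n \near \oo, d n < e.
  by move=> e0; exact: (near_infty_natSinv_lt (PosNum e0)).
have : cauchy (u @ \oo).
  apply: cauchy_exP => e e0.
  have ce0 : 0 < c / 4 * e ^+ 2 by rewrite mulr_gt0 ?exprn_gt0 ?divr_gt0.
  have [K _ KP] := d_small _ ce0.
  exists (u K); exists K => // n /= Kn.
  rewrite -ball_normE /= -(@ltr_pXn2r _ 2) ?nnegrE// ?ltW//.
  have := udist K n; have := KP K (leqnn _); have := KP n Kn; rewrite /=.
  move=> H1 H2 H3.
  by rewrite -(@ltr_pM2l _ (c / 2)) ?divr_gt0//; lra.
move=> /cauchy_cvgP u_cvg; pose x : X := lim (u @ \oo).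
have ux : u @ \oo --> x by [].
exists x => h; apply/eqP; rewrite -subr_eq0 -sqrf_eq0 eq_le sqr_ge0 andbT.
(* The squared residual at [x] will be at most [K * r], hence at most [e]; the minimum with 1 in [r]
   ensures [r ^+ 2 <= r]. *)
pose K := 2 * ((`|M| * `|h|) ^+ 2 + (a h h + 1)).
have K0 : 0 < K.
  by rewrite mulr_gt0// ltr_wpDl ?sqr_ge0// ltr_wpDl.
apply/ler_addgt0Pr => e e0; rewrite add0r.
pose r := Num.min 1 (e / K).
have r0 : 0 < r by rewrite lt_min ltr01 divr_gt0.
have [n [dn un]] : exists n, d n < r /\ `|x - u n| < r.
  have [n1 _ n1P] := d_small r r0.
  have /cvgrPdist_lt/(_ r r0)[n2 _ n2P] := ux.
  by exists (maxn n1 n2); split; [apply: n1P|apply: n2P] => /=;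
    rewrite ?leq_maxl ?leq_maxr.
(* On the line through [u n] in direction [h] the energy stays above [m], while [u n] exceeds [m] by
   less than [d n]. *)
have gn : (a (u n) h - f h) ^+ 2 <= (a h h + 1) * d n.
  apply: sqr_le_of_quadratic_ge0 => // t.
  by have := qm (t *: h + u n); rewrite qE; have := uP n; lra.
have ge : (a (x - u n) h) ^+ 2 <= (`|M| * `|h|) ^+ 2 * r ^+ 2.
  rewrite -exprMn -real_normK ?num_real// lerXn2r ?nnegrE ?mulr_ge0 ?(ltW r0)//.
  rewrite (le_trans (aM _ _))// mulrAC (@le_trans _ _ (`|M| * `|h| * `|x - u n|))//.
    by rewrite !ler_wpM2r// ler_norm.
  by rewrite ler_wpM2l ?mulr_ge0 ?(ltW un).
have aB : a (x - u n) h = a x h - a (u n) h.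
  by rewrite addrC -scaleN1r a_linear; ring.
have r1 : r <= 1 by rewrite ge_min lexx.
have rr : r ^+ 2 <= r by rewrite expr2 ler_piMr// ltW.
have Kr : K * r <= e.
  by rewrite mulrC -ler_pdivlMr// ge_min lexx orbT.
apply: le_trans Kr.
have -> : a x h - f h = a (x - u n) h + (a (u n) h - f h) by rewrite aB; ring.
have := sqr_ge0 (a (x - u n) h - (a (u n) h - f h)).
have : (a h h + 1) * d n <= (a h h + 1) * r.
  by rewrite ler_wpM2l ?ltW// ltr_wpDl.
have : (`|M| * `|h|) ^+ 2 * r ^+ 2 <= (`|M| * `|h|) ^+ 2 * r.
  by rewrite ler_wpM2l ?sqr_ge0.
rewrite /K; move: gn ge; move: (a (x - u n) h) (a (u n) h - f h) => A B; nra.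
Qed.
End symmetric_forms.

(** * Variational problems on subspaces *)

Section finite_dimension.
Context {R : realType} {X : hilbertType R}.

Lemma linear_subspaceB (S : set X) x y : linear_subspace S ->
  S x -> S y -> S (x - y).
Proof. by move=> [_ SP] Sx Sy; rewrite addrC -scaleN1r; exact: SP. Qed.

Lemma fin_dim_linear (S : set X) : fin_dim_subspace S -> linear_subspace S.
Proof.
move=> [n [e ->]]; split.
  by exists (fun=> 0) => //; rewrite big1// => i _; rewrite scale0r.
move=> k _ _ [c _ <-] [c' _ <-]; exists (fun i => k * c i + c' i) => //.
rewrite scaler_sumr -big_split; apply: eq_bigr => i _ /=.
by rewrite scalerDl scalerA.
Qed.

(** Allows induction on the number of spanning vectors, which may be linearly dependent. *)
Lemma fin_dim_recl (n : nat) (e : 'I_n.+1 -> X) (t : X) :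
  [set \sum_(i < n.+1) c i *: e i | c in [set: 'I_n.+1 -> R]] t <->
  exists k : R, exists2 t', [set \sum_(i < n) c i *: e (lift ord0 i) |
    c in [set: 'I_n -> R]] t' & t = k *: e ord0 + t'.
Proof.
split=> [[c _ <-]|[k [_ [c _ <-] ->]]].
  exists (c ord0), (\sum_(i < n) c (lift ord0 i) *: e (lift ord0 i)).
    by exists (fun i => c (lift ord0 i)).
  by rewrite big_ord_recl.
exists (fun i => oapp c k (unlift ord0 i)) => //.
rewrite big_ord_recl unlift_none /=; congr (_ + _).
by apply: eq_bigr => i _; rewrite liftK.
Qed.

(* Gram-Schmidt: the new basis vector is first made orthogonal to the previous
   ones; anisotropy says that it then vanishes or has nonzero square. *)
Lemma fin_dim_solve (a : X -> X -> R) (S : set X) (f : X -> R) :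
  (forall k x y z, a (k *: x + y) z = k * a x z + a y z) ->
  (forall x y, a x y = a y x) ->
  fin_dim_subspace S -> (forall s, S s -> a s s = 0 -> s = 0) -> scalar f ->
  exists2 s, S s & forall t, S t -> a s t = f t.
Proof.
move=> al aC [n [e ->]]; elim: n => [|n IHn] in e f *.
  move=> _ fl; have f0 : f 0 = 0.
    by have := fl (-1) 0 0; rewrite scaler0 addr0 /=; lra.
  have a0 z : a 0 z = 0 by have := al (-1) 0 0 z; rewrite scaler0 addr0; lra.
  exists 0; first by exists (fun=> 0) => //; rewrite big_ord0.
  by move=> _ [c _ <-]; rewrite big_ord0 a0 f0.
pose S' := [set \sum_(i < n.+1) c i *: e i | c in [set: 'I_n.+1 -> R]].
rewrite -/S' => an fl.
pose e' i := e (lift ord0 i).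
pose S0 := [set \sum_(i < n) c i *: e' i | c in [set: 'I_n -> R]].
have S0l : linear_subspace S0 by apply: fin_dim_linear; exists n, e'.
have S0S t : S0 t -> S' t.
  by move=> ?; apply/fin_dim_recl; exists 0, t => //; rewrite scale0r add0r.
have an' s : S0 s -> a s s = 0 -> s = 0 by move=> /S0S; exact: an.
(* [p] is the [a]-projection of [e ord0] onto [S0], so that [e1] is [a]-orthogonal to [S0]. *)
have [p pS p_e] := IHn e' (a (e ord0)) an'
  (fun k x y => symmetric_formPr a al aC k x y (e ord0)).
have [s0 s0S s0P] := IHn e' f an' fl.
pose e1 := e ord0 - p.
have e1S t : S0 t -> a e1 t = 0.
  by move=> tS; rewrite /e1 addrC -scaleN1r al (p_e t tS); ring.
have [|a1] := eqVneq (a e1 e1) 0.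
  have e1S' : S' e1.
    apply/fin_dim_recl; exists 1, (- p); rewrite ?scale1r//.
    by rewrite -sub0r; apply: (linear_subspaceB _ _ _ S0l) => //; case: S0l.
  move=> /(an _ e1S')/eqP; rewrite subr_eq0 => /eqP e0p.
  exists s0; first exact: S0S.
  move=> t /fin_dim_recl[k [t' t'S ->]]; apply: s0P; rewrite e0p.
  by case: S0l => _; apply.
(* [k1] makes the equation hold on [e1]; by orthogonality the equations on [S0], already solved by
   [s0], are not disturbed. *)
pose k1 := (f e1 - a s0 e1) / a e1 e1.
exists (k1 *: e1 + s0).
  apply/fin_dim_recl; exists k1, (- k1 *: p + s0); first by case: S0l => _; apply.
  by rewrite /e1 scalerBr scaleNr addrA.
move=> t /fin_dim_recl[k [t' t'S ->]].
have -> : k *: e ord0 + t' = k *: e1 + (k *: p + t').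
  by rewrite /e1 scalerBr addrA subrK.
have ptS : S0 (k *: p + t') by case: S0l => _; apply.
rewrite (symmetric_formPr a al aC k e1) fl /= !al (e1S _ ptS) (s0P _ ptS) /k1.
by field.
Qed.

End finite_dimension.

(** * Riesz representation and orthogonal projection *)

Section riesz_representation.
Context {R : realType} {X : hilbertType R}.

(** Lax-Milgram for the inner product itself yields a representer, so [xget] does not fall back on
    its default 0. *)
Lemma riesz_invK (f : X -> R) : bounded_functional f ->
  forall x, inner (riesz_inv f) x = f x.
Proof.
move=> fb x; have [z zP] : exists z, forall h : X, inner z h = f h.
  apply: (@lax_milgram_symmetric R X (fun x y => inner x y) _ _ f 1 1) => //.
  - by move=> *; exact: innerPl.
  - by move=> *; exact: innerC.
  - by move=> y; rewrite mul1r inner_sqr_norm.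
  - by move=> y z; rewrite mul1r cauchy_schwarz.
have /(congr1 (@^~ x)) : riesz (riesz_inv f) = f.
  by apply: (@xgetPex _ 0 [set x | riesz x = f]); exists z; apply/funext.
by [].
Qed.

Lemma inner_ext (S : set X) x y : linear_subspace S -> S x -> S y ->
  (forall s, S s -> inner x s = inner y s) -> x = y.
Proof.
move=> Sl Sx Sy xy; apply/eqP; rewrite -subr_eq0 -normr_eq0 -sqrf_eq0.
rewrite -inner_sqr_norm linearBl /= subr_eq0; apply/eqP/xy.
exact: linear_subspaceB.
Qed.

(** The orthogonal projection onto [S] is the minimiser, by Pythagoras. This replaces the infima of
    the estimates by concrete approximants. *)
Lemma best_approx_attained (S : set X) x : fin_dim_subspace S ->
  exists2 w, S w & `|x - w| ^+ 2 <= best_approx_sq S x.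
Proof.
move=> Sf; have Sl := fin_dim_linear _ Sf.
have [w Sw wP] : exists2 w, S w & forall t, S t -> inner w t = inner x t.
  apply: (@fin_dim_solve R X (fun x y => inner x y) S (inner x)) => //.
  - by move=> *; exact: innerPl.
  - by move=> *; exact: innerC.
  - move=> s _; rewrite inner_sqr_norm => /eqP.
    by rewrite sqrf_eq0 normr_eq0 => /eqP.
  - by move=> k u v; rewrite innerPr.
exists w => //; apply: lb_le_inf; first by exists (`|x - w| ^+ 2), w.
move=> _ [w' Sw' <-].
have -> : x - w' = (x - w) + (w - w') by rewrite addrA subrK.
rewrite (sqr_normD (x - w)) (_ : inner (x - w) (w - w') = 0).
  by rewrite mulr0 addr0 lerDl sqr_ge0.
by rewrite linearBl /= wP ?subrr//; exact: linear_subspaceB.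
Qed.

End riesz_representation.
(** * Petrov-Galerkin discretization *)

Section petrov_galerkin.
Context {R : realType} {Y V : hilbertType R}.
Variables (b : {bilinear Y -> V -> R | *%R & *%R}) (Mb Cb : R).
Hypothesis Mb0 : 0 <= Mb.
Hypothesis bM : forall y v, `|b y v| <= Mb * `|y| * `|v|.
Hypothesis Cb0 : 0 < Cb.
Hypothesis b_inf_sup : inf_sup b Cb.

Let b_le y v : b y v <= Mb * `|y| * `|v|.
Proof. exact: le_trans (ler_norm _) (bM y v). Qed.

Lemma bounded_form_slice y : bounded_functional (b y).
Proof. by split; [move=> k u v; rewrite linearPr|exists (Mb * `|y|)]. Qed.

(** The form in which the inf-sup condition is applied. If [V] is trivial the supremum is 0, which
    is covered by [0 <= K]. *)
Lemma inf_sup_le y K : 0 <= K ->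
  (forall v, b y v <= K * `|v|) -> Cb * `|y| <= K.
Proof.
move=> K0 bK; apply: le_trans (b_inf_sup y) _.
set S := (X in sup X); have [->|/set0P S0] := eqVneq S set0; first by rewrite sup0.
apply: ge_sup => // _ [v /= v0 <-].
by rewrite ler_pdivrMr ?normr_gt0.
Qed.

Lemma le_of_sqr_le (x K : R) : 0 <= x -> 0 <= K -> x ^+ 2 <= K * x -> x <= K.
Proof.
move=> x0 K0; have [->//|xn0] := eqVneq x 0.
by rewrite expr2 ler_pM2r// lt_neqAle eq_sym xn0.
Qed.

(* Lax-Milgram for the least-squares form [(T y, T w)], where [T] is the Riesz
   lift of [b]; the residual is then orthogonal to the range of [T], hence 0. *)
Lemma state_solvable (g : V -> R) : nondegenerate_test b ->
  bounded_functional g -> exists y, forall v, b y v = g v.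
Proof.
move=> bnd gb.
pose T y := riesz_inv (b y).
have TE y v : inner (T y) v = b y v by apply/riesz_invK/bounded_form_slice.
have TM y : `|T y| <= Mb * `|y|.
  by rewrite le_of_sqr_le ?mulr_ge0// -inner_sqr_norm TE b_le.
have TC y : Cb * `|y| <= `|T y|.
  apply: inf_sup_le => // v; rewrite -TE.
  exact: le_trans (ler_norm _) (cauchy_schwarz _ _).
pose G := riesz_inv g.
(* The load [b w G] is [inner (T w) G]; coercivity with constant [Cb ^+ 2] is the inf-sup
   condition. *)
have [y yP] : exists y, forall w, inner (T y) (T w) = b w G.
  apply: (@lax_milgram_symmetric R Y (fun y w => inner (T y) (T w)) _ _
    (fun w => b w G) (Cb ^+ 2) (Mb ^+ 2)).
  - by move=> k x y z; rewrite !TE linearPl.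
  - by move=> x y; rewrite innerC.
  - by rewrite exprn_gt0.
  - by move=> y; rewrite inner_sqr_norm -exprMn lerXn2r ?nnegrE ?mulr_ge0 ?(ltW Cb0).
  - move=> y w; rewrite (le_trans (cauchy_schwarz _ _))//.
    have -> : Mb ^+ 2 * `|y| * `|w| = (Mb * `|y|) * (Mb * `|w|) by ring.
    exact: ler_pM.
  - split; first by move=> k u v; rewrite linearPl.
    by exists (Mb * `|G|) => w; rewrite mulrAC.
exists y => v.
have : [set v | forall y, b y v = 0] (T y - G).
  by move=> w /=; rewrite linearBr /= -yP -(TE w) innerC subrr.
by rewrite bnd => /eqP; rewrite subr_eq0 => /eqP TG; rewrite -TE TG riesz_invK.
Qed.

Variables (Yh : set Y) (Vh : set V) (CPi : R) (Pi : V -> V).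
Hypothesis Yhf : fin_dim_subspace Yh.
Hypothesis Vhf : fin_dim_subspace Vh.
Hypothesis CPi0 : 0 < CPi.
Hypothesis PiP : fortin b Yh Vh CPi Pi.

Local Notation Th := (Theta b Vh).
Local Notation k := (CPi / Cb).

Let Yhl : linear_subspace Yh := fin_dim_linear _ Yhf.
Let Vhl : linear_subspace Vh := fin_dim_linear _ Vhf.

(** The defining problem is solvable on the finite-dimensional [Vh], so [xget] picks a genuine
    solution. *)
Lemma ThetaP y : Vh (Th y) /\ forall vh, Vh vh -> inner (Th y) vh = b y vh.
Proof.
apply: (@xgetPex _ 0 [set t | Vh t /\ forall vh, Vh vh -> inner t vh = b y vh]).
have [t Vt tP] : exists2 t, Vh t & forall vh, Vh vh -> inner t vh = b y vh.
  apply: (@fin_dim_solve R V (fun x y => inner x y) Vh (b y)) => //.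
  - by move=> *; exact: innerPl.
  - by move=> *; exact: innerC.
  - move=> s _; rewrite inner_sqr_norm => /eqP.
    by rewrite sqrf_eq0 normr_eq0 => /eqP.
  - by move=> c u v; rewrite linearPr.
by exists t.
Qed.

Let Th_in y : Vh (Th y) := proj1 (ThetaP y).
Let ThE y := proj2 (ThetaP y).

Lemma Theta_linear c y z : Th (c *: y + z) = c *: Th y + Th z.
Proof.
apply: (inner_ext Vh) => // [|v Vv]; first by case: Vhl => _; apply.
by rewrite innerPl !ThE// linearPl.
Qed.

(** By the Fortin property, [b y v = b y (Pi v) = inner (Th y) (Pi v)], which is at most
    [CPi * |Th y| * |v|]; the inf-sup condition concludes. *)
Lemma Theta_stable y : Yh y -> `|y| <= k * `|Th y|.
Proof.
case: PiP => PiV PiC Pib Yy; rewrite mulrAC ler_pdivlMr// mulrC.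
apply: inf_sup_le => [|v]; first by rewrite mulr_ge0 ?(ltW CPi0).
have := Pib y v Yy; rewrite linearBr /= => /eqP; rewrite subr_eq0 => /eqP ->.
rewrite -ThE// (le_trans (ler_norm _))// (le_trans (cauchy_schwarz _ _))//.
by rewrite mulrAC mulrC ler_wpM2r.
Qed.

(** By stability the form [inner (Th y) (Th w)] is definite on [Yh]. The discrete state and adjoint
    problems both reduce to it. *)
Lemma discrete_solvable (g : Y -> R) : scalar g ->
  exists2 y, Yh y & forall w, Yh w -> inner (Th y) (Th w) = g w.
Proof.
move=> gl; apply: (@fin_dim_solve R Y (fun y w => inner (Th y) (Th w)) Yh g) => //.
- by move=> c x y z; rewrite Theta_linear innerPl.
- by move=> *; exact: innerC.
- move=> s Ys; rewrite inner_sqr_norm => /eqP; rewrite sqrf_eq0 => /eqP Ts.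
  by have := Theta_stable s Ys; rewrite Ts mulr0 normr_le0 => /eqP.
Qed.

Lemma discrete_state_solvable (g : V -> R) : scalar g ->
  exists2 y, Yh y & forall v, (Th @` Yh) v -> b y v = g v.
Proof.
move=> gl; have [|y Yy yP] := discrete_solvable (g \o Th).
  by move=> c u v /=; rewrite Theta_linear gl.
by exists y => // _ [w Yw <-]; rewrite -ThE// yP.
Qed.

Lemma discrete_adjoint_solvable (g : Y -> R) : scalar g ->
  exists2 lam, Yh lam & forall w, Yh w -> b w (Th lam) = g w.
Proof.
move=> gl; have [y Yy yP] := discrete_solvable g gl.
by exists y => // w Yw; rewrite -ThE// innerC yP.
Qed.

(** Makes a discrete adjoint an admissible test function in the discrete state equation. *)
Lemma discrete_adjoint_Theta lam p : Vh p ->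
  (forall v, Vh v -> inner p v - b lam v = 0) -> p = Th lam.
Proof.
move=> Vp pP; apply: (inner_ext Vh) => // v Vv.
by rewrite ThE//; apply/eqP; rewrite -subr_eq0 pP.
Qed.

Let k0 : 0 <= k. Proof. by rewrite divr_ge0 ?ltW. Qed.

(** Testing with [Th (yh - w)] and stability bound [yh - w]. The number [r] measures the mismatch of
    the loads of [y] and [yh]. *)
Lemma state_error y yh w r : Yh yh -> Yh w -> 0 <= r ->
  (forall z, Yh z -> b yh (Th z) - b y (Th z) <= r * `|Th z|) ->
  `|y - yh| <= (1 + k * Mb) * `|y - w| + k * r.
Proof.
move=> Yy Yw r0 err; pose z := yh - w.
have Yz : Yh z by exact: linear_subspaceB.
have Tz : `|Th z| <= r + Mb * `|y - w|.
  apply: le_of_sqr_le; rewrite ?addr_ge0 ?mulr_ge0// -inner_sqr_norm ThE//.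
  have -> t : b z t = b yh t - b y t + b (y - w) t.
    by rewrite /z !linearBl /=; ring.
  by have := err z Yz; have := b_le (y - w) (Th z); lra.
have := ler_wpM2l k0 Tz; have := Theta_stable z Yz.
have := ler_normB (y - w) z.
by rewrite {1}/z opprB addrA subrK; lra.
Qed.

(** A quasi-optimality estimate for the mixed system; [s] measures the mismatch of the right-hand
    sides of the adjoint equations. *)
Lemma adjoint_error p lam ph lamh v w s : Yh lamh -> Vh ph -> Vh v -> Yh w ->
  0 <= s -> (forall v', inner p v' = b lam v') ->
  (forall v', Vh v' -> inner ph v' = b lamh v') ->
  (forall z, Yh z -> b z ph - b z p <= s * `|z|) ->
  `|p - ph| <= (3 + k * Mb) * `|p - v| + 2 * Mb * `|lam - w| + k * s.
Proof.
move=> Yl Vp Vv Yw s0 pE phE err.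
pose ep := ph - v; pose el := lamh - w.
have Vep : Vh ep by exact: linear_subspaceB.
have Yel : Yh el by exact: linear_subspaceB.
pose rho := `|p - v| + Mb * `|lam - w|.
have rho0 : 0 <= rho by rewrite addr_ge0 ?mulr_ge0.
have consistency v' : Vh v' -> `|inner ep v' - b el v'| <= rho * `|v'|.
  move=> Vv'; have -> : inner ep v' - b el v' = inner (p - v) v' - b (lam - w) v'.
    by rewrite !linearBl /= pE phE//; ring.
  by rewrite (le_trans (ler_normB _ _))// mulrDl lerD// cauchy_schwarz.
pose sigma := Mb * `|p - v| + s.
have sigma0 : 0 <= sigma by rewrite addr_ge0 ?mulr_ge0.
have b_ep : b el ep <= `|el| * sigma.
  have -> : b el ep = b el ph - b el p + b el (p - v).
    by rewrite /ep !linearBr /=; ring.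
  by have := err el Yel; have := b_le el (p - v); rewrite /sigma; lra.
have T_ep : inner (Th el) ep = b el ep by exact: ThE.
(* Test with [Th el]: the cross term [inner ep (Th el)] equals [b el ep], at most [|el| * sigma],
   and stability turns [|el|] into [k * |Th el|]. *)
have Tel : `|Th el| <= rho + k * sigma.
  have K0 : 0 <= rho + k * sigma by exact: addr_ge0 rho0 (mulr_ge0 k0 sigma0).
  apply: le_of_sqr_le => //; rewrite -inner_sqr_norm ThE//.
  have := ler_wpM2r sigma0 (Theta_stable el Yel).
  have := consistency (Th el) (Th_in el).
  rewrite (innerC ep) T_ep ler_norml => /andP[+ _].
  by move: b_ep; lra.
(* Now test with [ep], where [b el ep = inner (Th el) ep]. *)
have epB : `|ep| <= `|Th el| + rho.
  apply: le_of_sqr_le; [by []|exact: addr_ge0|rewrite -inner_sqr_norm].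
  have := consistency ep Vep; rewrite ler_norml => /andP[_].
  have := ler_norm (inner (Th el) ep); have := cauchy_schwarz (Th el) ep.
  by rewrite T_ep; lra.
have := ler_normB (p - v) ep; rewrite {1}/ep opprB addrA subrK.
by move: Tel epB; rewrite /rho /sigma; lra.
Qed.

End petrov_galerkin.
(** * Optimality conditions *)

Section optimality.
Context {R : realType} {Y V U Z : hilbertType R}.
Variables (b : {bilinear Y -> V -> R | *%R & *%R}) (O : Y -> Z).
Variables (D : U -> V -> R) (yd : Z) (alpha : R).
Hypothesis O_linear : linear O.
Hypothesis D_linear : forall a u1 u2 v, D (a *: u1 + u2) v = a * D u1 v + D u2 v.

Lemma ge0_of_quadratic_ge0 (g s : R) :
  (forall t, 0 < t -> t <= 1 -> 0 <= t * g + t ^+ 2 * s) -> 0 <= g.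
Proof.
move=> gP; rewrite leNgt; apply/negP => g0.
(* With this [c], [t * c <= - g] forces [t * |s| <= - g / 2], so [g + t * s] would be negative. *)
pose c := 2 * (`|s| + 1); have c0 : 0 < c by rewrite mulr_gt0// ltr_wpDl.
pose t := Num.min 1 (- g / c).
have t0 : 0 < t by rewrite lt_min ltr01 divr_gt0// oppr_gt0.
have t1 : t <= 1 by rewrite ge_min lexx.
have tc : t * c <= - g by rewrite -ler_pdivlMr// ge_min lexx orbT.
have := gP t t0 t1.
have -> : t * g + t ^+ 2 * s = t * (g + t * s) by ring.
rewrite pmulr_rge0//.
have := ler_wpM2l (ltW t0) (ler_norm s).
have : 0 <= t * `|s| by rewrite mulr_ge0 ?(ltW t0).
by move: tc; rewrite /c; lra.
Qed.

Lemma cost_expand (t : R) (y dy : Y) (u du : U) :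
  cost O yd alpha (t *: dy + y, t *: du + u) = cost O yd alpha (y, u) +
  (t * (inner (O y - yd) (O dy) + alpha * inner u du) +
   t ^+ 2 * (2^-1 * `|O dy| ^+ 2 + alpha / 2 * `|du| ^+ 2)).
Proof.
rewrite /cost /= O_linear -addrA (sqr_normD (t *: O dy)) (sqr_normD (t *: du)).
rewrite !normrZ !exprMn !real_normK ?num_real// !innerZl.
by rewrite (innerC (O dy)) (innerC du); field.
Qed.

(** Feasible pairs form a convex set, so the directional derivative of the cost at a minimiser is
    nonnegative; testing the state equations with [p] eliminates the state. Stated for general [A],
    [W], [K] to serve the continuous and the discrete problem. *)
Lemma variational_inequality (A : set Y) (W : set V) (K : set U) y u p y' u' :
  linear_subspace A ->
  (forall t x z, 0 < t -> t <= 1 -> K x -> K z -> K (t *: (z - x) + x)) ->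
  minimizer (cost O yd alpha) (feasible b D A W K) (y, u) ->
  W p -> (forall w, A w -> b w p = inner (O y - yd) (O w)) ->
  feasible b D A W K (y', u') ->
  0 <= D u' p - D u p + alpha * inner u (u' - u).
Proof.
move=> Al Kc [[/= Ay Ku st] opt] Wp adj [/= Ay' Ku' st'].
have Ady : A (y' - y) by exact: linear_subspaceB.
rewrite -(st _ Wp) -(st' _ Wp) -linearBl /= adj//.
apply: (@ge0_of_quadratic_ge0 _
  (2^-1 * `|O (y' - y)| ^+ 2 + alpha / 2 * `|u' - u| ^+ 2)) => t t0 t1.
rewrite -(lerD2l (cost O yd alpha (y, u))) addr0 -cost_expand; apply: opt.
split => /= [| |v Wv]; [by case: Al => _; apply|exact: Kc|].
have Bl u1 u2 : D (u1 - u2) v = D u1 v - D u2 v.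
  by rewrite addrC -scaleN1r D_linear; ring.
by rewrite linearPl /= linearBl /= D_linear Bl st// st'.
Qed.

End optimality.

Lemma convex_set_segment (R : realType) (U : hilbertType R) (K : set U) t x z :
  convex_set K -> 0 < t -> t <= 1 -> K x -> K z -> K (t *: (z - x) + x).
Proof.
move=> Kc t0 t1 Kx Kz.
have := Kc z x (@Itv01 R t (ltW t0) t1); rewrite !inE => /(_ Kz Kx).
rewrite [conv _ _ _](_ : _ = t *: (z - x) + x)// /conv /= /unstable.onem.
by rewrite scalerBl scale1r scalerBr addrCA addrC.
Qed.

(** * Nonnegative operator bounds and squared sums *)

Lemma operator_bound (R : realType) (X Z : normedModType R) (f : X -> Z) :
  (exists M, forall x, `|f x| <= M * `|x|) ->
  exists2 M, 0 <= M & forall x, `|f x| <= M * `|x|.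
Proof.
move=> [M fM]; exists `|M| => // x.
by rewrite (le_trans (fM x))// ler_wpM2r// ler_norm.
Qed.

Lemma form_bound (R : realType) (X Z : normedModType R) (b : X -> Z -> R) :
  (exists M, forall x z, `|b x z| <= M * `|x| * `|z|) ->
  exists2 M, 0 <= M & forall x z, `|b x z| <= M * `|x| * `|z|.
Proof.
move=> [M bM]; exists `|M| => // x z.
by rewrite (le_trans (bM x z))// !ler_wpM2r// ler_norm.
Qed.

Lemma sqrD_le2 (R : realType) (x y G : R) z :
  0 <= z -> 0 <= G -> 0 <= x -> 0 <= y -> z <= G * (x + y) ->
  z ^+ 2 <= 2 * G ^+ 2 * (x ^+ 2 + y ^+ 2).
Proof.
move=> z0 G0 x0 y0 zG.
have : z ^+ 2 <= (G * (x + y)) ^+ 2 by rewrite lerXn2r ?nnegrE ?mulr_ge0 ?addr_ge0.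
have : 0 <= G ^+ 2 * (x - y) ^+ 2 by rewrite mulr_ge0 ?sqr_ge0.
by move=> H1 H2; rewrite (le_trans H2)//; lra.
Qed.

Lemma sqrD_le3 (R : realType) (x y t G : R) z :
  0 <= z -> 0 <= G -> 0 <= x -> 0 <= y -> 0 <= t -> z <= G * (x + y + t) ->
  z ^+ 2 <= 3 * G ^+ 2 * (x ^+ 2 + y ^+ 2 + t ^+ 2).
Proof.
move=> z0 G0 x0 y0 t0 zG.
have : z ^+ 2 <= (G * (x + y + t)) ^+ 2.
  by rewrite lerXn2r ?nnegrE ?mulr_ge0 ?addr_ge0.
have : 0 <= G ^+ 2 * ((x - y) ^+ 2 + (x - t) ^+ 2 + (y - t) ^+ 2).
  by rewrite mulr_ge0 ?addr_ge0 ?sqr_ge0.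
by move=> H1 H2; rewrite (le_trans H2)//; lra.
Qed.

(** * Error estimates for control, state and adjoint *)

Theorem theorem4p5 (R : realType) (U Y V Z : hilbertType R)
    (b : {bilinear Y -> V -> R | *%R & *%R}) (O : Y -> Z) (D : U -> V -> R)
    (Cb CPi : R) :
  bounded_form b -> bounded_operator O -> bounded_operator_to_dual D ->
  0 < Cb -> inf_sup b Cb -> nondegenerate_test b -> 0 < CPi ->
  exists C1 C : R, [/\ 0 < C1, 0 < C &
    forall (Uad : set U) (yd : Z) (alpha : R)
      (Vh : set V) (Yh : set Y) (Uh : set U) (Pi : V -> V)
      (y : Y) (u : U) (yh : Y) (uh : U) (lam lamh : Y) (p ph : V),
    Uad !=set0 -> bounded_set Uad -> closed Uad -> convex_set Uad ->
    0 < alpha ->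
    fin_dim_subspace Vh -> fin_dim_subspace Yh -> linear_subspace Uh ->
    Uh `&` Uad !=set0 ->
    fortin b Yh Vh CPi Pi ->
    optimal_control b D O yd alpha Uad y u ->
    discrete_optimal_control b D O yd alpha Yh Vh (Uh `&` Uad) yh uh ->
    optimal_adjoint b O yd y lam p ->
    discrete_optimal_adjoint b O yd Yh Vh yh lamh ph ->
    [/\ alpha ^+ 2 * `|u - uh| ^+ 2 <=
          C1 * (alpha *
            inf [set inner (riesz_inv (dual_op_to_dual D ph) + alpha *: uh)
                       (wh - u) | wh in Uh `&` Uad]) +
          C * (best_approx_sq Yh y + best_approx_sq Vh p +
               best_approx_sq Yh lam),
        `|y - yh| ^+ 2 <= C * (best_approx_sq Yh y + `|u - uh| ^+ 2) &
        `|p - ph| ^+ 2 <=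
          C * (best_approx_sq Vh p + best_approx_sq Yh lam +
               best_approx_sq Yh y + `|u - uh| ^+ 2)]].
Proof.
move=> /form_bound[Mb Mb0 bM] [Ol /operator_bound[MO MO0 OM]].
move=> [Db Dl /form_bound[MD MD0 DM]] Cb0 bis bnd CPi0.
pose k := CPi / Cb; have k0 : 0 < k by rewrite divr_gt0.
(* [G] dominates every constant of the state and adjoint estimates as well as [MD]; [1 <= G] lets
   all powers be raised to the sixth. *)
pose G := 3 + k * Mb + 2 * Mb + k * MO ^+ 2 + k * MD + MD.
have [kMb0 kMO0 kMD0] : [/\ 0 <= k * Mb, 0 <= k * MO ^+ 2 & 0 <= k * MD].
  by split; apply: mulr_ge0; rewrite ?sqr_ge0 ?(ltW k0).
have G1 : 1 <= G by rewrite /G; lra.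
have G0 : 0 <= G by lra.
have GM (m : nat) : 1 <= G ^+ m by rewrite exprn_ege1.
(* The 2 pays for the half absorbed by Young's inequality; [6 * G ^+ 6] is the product of [G ^+ 2]
   from Young, [3 * G ^+ 2] from the adjoint and [2 * G ^+ 2] from the state. *)
exists 2, (6 * G ^+ 6); split=> //; first by have := GM 6%N; lra.
move=> Uad yd alpha Vh Yh Uh Pi y u yh uh lam lamh p ph.
move=> _ _ _ Uc a0 Vf Yf Uhl UhU0 PiP opt opth [_ _ pE adj] [Yl Vp phE adjh].
have Yhl := fin_dim_linear _ Yf.
pose Th := Theta b Vh; pose W := [set Th x | x in Yh].
have [[_ /= Uu st] _] := opt.
have [[/= Yy [Uhu Uuh] sth] _] := opth.
rewrite /= in adj adjh.
have WTh z : Yh z -> W (Th z) by move=> Yz; exists z.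
have [yhat Yyhat sthat] : exists2 z, Yh z & forall v, W v -> b z v = D u v.
  apply: (@discrete_state_solvable _ _ _ b Cb Cb0 bis Yh Vh CPi Pi) => //.
  by case: (Db u).
have adjhat_lin : scalar (fun w => inner (O yhat - yd) (O w)).
  by move=> c v w; rewrite Ol innerPr.
have [lamhat Ylamhat adjhat] := @discrete_adjoint_solvable _ _ _ b Cb Cb0 bis
  Yh Vh CPi Pi Yf Vf CPi0 PiP _ adjhat_lin.
pose phat := Th lamhat.
have phTh : ph = Th lamh by exact: discrete_adjoint_Theta phE.
have ThP z := ThetaP b Vh Vf z.
have Wph : W ph by rewrite phTh; exact: WTh.
have Wphat : W phat by exact: WTh.
have DB v u1 u2 : D (u1 - u2) v = D u1 v - D u2 v.
  by rewrite addrC -scaleN1r Dl; ring.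
(* The control [uz] is left free: it will be [uh] for [yh] and [u] for [yhat]. *)
have state_err z uz wy : Yh z -> (forall v, W v -> b z v = D uz v) -> Yh wy ->
    `|y - z| <= G * (`|y - wy| + `|u - uz|).
  move=> Yz stz Ywy.
  have := @state_error _ _ _ b Mb Cb Mb0 bM Cb0 bis Yh Vh CPi Pi Yf Vf CPi0 PiP
    y z wy (MD * `|u - uz|) Yz Ywy (mulr_ge0 MD0 (normr_ge0 _)).
  rewrite -/k -/Th => /(_ _) H.
  have {}H : `|y - z| <= (1 + k * Mb) * `|y - wy| + k * (MD * `|u - uz|).
    apply: H => v Yv; rewrite stz ?st//; last exact: WTh.
    by rewrite -DB distrC (le_trans (ler_norm _)).
  apply: (le_trans H); rewrite mulrDr mulrA lerD// ler_wpM2r// /G; lra.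
have adj_err z q l wv wl : Yh z -> Yh l -> Vh q ->
    (forall v, Vh v -> inner q v = b l v) ->
    (forall w, Yh w -> b w q = inner (O z - yd) (O w)) -> Vh wv -> Yh wl ->
    `|p - q| <= G * (`|p - wv| + `|lam - wl| + `|y - z|).
  move=> Yz Yl' Vq qE adjz Vwv Ywl.
  have := @adjoint_error _ _ _ b Mb Cb Mb0 bM Cb0 bis Yh Vh CPi Pi Yf Vf CPi0 PiP
    p lam q l wv wl (MO ^+ 2 * `|y - z|) Yl' Vq Vwv Ywl
    (mulr_ge0 (sqr_ge0 _) (normr_ge0 _)).
  rewrite -/k => H.
  have {}H : `|p - q| <= (3 + k * Mb) * `|p - wv| + 2 * Mb * `|lam - wl| +
      k * (MO ^+ 2 * `|y - z|).
    apply: H => // [v|w Yw].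
      by apply/eqP; rewrite -subr_eq0 pE.
    rewrite adjz// adj// /dual_op /riesz -linearBl /=.
    have -> : O z - yd - (O y - yd) = O (z - y).
      rewrite opprB addrA subrK [in RHS]addrC -[in RHS]scaleN1r Ol.
      by rewrite scaleN1r addrC.
    rewrite (le_trans (ler_norm _))// (le_trans (cauchy_schwarz _ _))//.
    have -> : MO ^+ 2 * `|y - z| * `|w| = (MO * `|z - y|) * (MO * `|w|).
      by rewrite (distrC y); ring.
    exact: ler_pM.
  apply: (le_trans H); rewrite !mulrDr [k * (_ * _)]mulrA.
  by rewrite !lerD// ler_wpM2r// /G; lra.
have [wy Ywy wyE] := best_approx_attained Yh y Yf.
have [wv Vwv wvE] := best_approx_attained Vh p Vf.
have [wl Ywl wlE] := best_approx_attained Yh lam Yf.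
set By := best_approx_sq Yh y in wyE *; set Bp := best_approx_sq Vh p in wvE *.
set Bl := best_approx_sq Yh lam in wlE *.
have [By0 Bp0 Bl0] : [/\ 0 <= By, 0 <= Bp & 0 <= Bl].
  split; [apply: le_trans wyE|apply: le_trans wvE|apply: le_trans wlE];
    exact: sqr_ge0.
have G6 (m : nat) : (m <= 6)%N -> G ^+ m <= G ^+ 6 by exact: ler_weXn2l.
have yyh : `|y - yh| ^+ 2 <= 2 * G ^+ 2 * (By + `|u - uh| ^+ 2).
  have H := state_err yh uh wy Yy sth Ywy.
  apply: (le_trans (sqrD_le2 _ _ _ _ _ _ _ _ _ H)) => //.
  by rewrite ler_wpM2l ?mulr_ge0 ?sqr_ge0// lerD2r.
(* Since [yhat] has control [u], the control term vanishes; hence the bound on [p - phat] is free of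
   [u - uh]. *)
have yyhat : `|y - yhat| ^+ 2 <= 2 * G ^+ 2 * By.
  have := sqrD_le2 _ _ _ _ _ _ _ _ _ (state_err yhat u wy Yyhat sthat Ywy).
  rewrite subrr normr0 expr0n /= addr0 => /(_ _ _ _ _) H.
  by rewrite (le_trans (H _ _ _ _))// ler_wpM2l ?mulr_ge0 ?sqr_ge0.
have pph : `|p - ph| ^+ 2 <= 3 * G ^+ 2 * (Bp + Bl + `|y - yh| ^+ 2).
  have := adj_err yh ph lamh wv wl Yy Yl Vp _ _ Vwv Ywl.
  move=> H; apply: (le_trans (sqrD_le3 _ _ _ _ _ _ _ _ _ _ _ (H _ _))) => //.
  - by move=> v Vv; apply/eqP; rewrite -subr_eq0 phE.
  - by rewrite ler_wpM2l ?mulr_ge0 ?sqr_ge0// lerD2r lerD.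
have pphat : `|p - phat| ^+ 2 <= 3 * G ^+ 2 * (Bp + Bl + `|y - yhat| ^+ 2).
  have := adj_err yhat phat lamhat wv wl Yyhat Ylamhat
    (proj1 (ThP _)) (proj2 (ThP _)) adjhat Vwv Ywl.
  move=> H; apply: (le_trans (sqrD_le3 _ _ _ _ _ _ _ _ _ _ _ H)) => //.
  by rewrite ler_wpM2l ?mulr_ge0 ?sqr_ge0// lerD2r lerD.
have G42 := G6 4%N isT; have G22 := G6 2%N isT.
have e0 := sqr_ge0 `|u - uh|.
split; last first.
- apply: (le_trans pph).
  have : 3 * G ^+ 2 * `|y - yh| ^+ 2 <=
      3 * G ^+ 2 * (2 * G ^+ 2 * (By + `|u - uh| ^+ 2)).
    by rewrite ler_wpM2l ?mulr_ge0 ?sqr_ge0.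
  have -> : 3 * G ^+ 2 * (2 * G ^+ 2 * (By + `|u - uh| ^+ 2)) =
    6 * (G ^+ 4 * (By + `|u - uh| ^+ 2)) by ring.
  have := ler_wpM2r (addr_ge0 By0 e0) G42.
  have := ler_wpM2r (addr_ge0 Bp0 Bl0) G22.
  have : 0 <= G ^+ 6 * (Bp + Bl) by rewrite mulr_ge0 ?addr_ge0 ?exprn_ge0.
  by lra.
- apply: (le_trans yyh).
  have := ler_wpM2r (addr_ge0 By0 e0) G22.
  have : 0 <= G ^+ 6 * (By + `|u - uh| ^+ 2).
    by rewrite mulr_ge0 ?addr_ge0 ?exprn_ge0.
  by lra.
have Uad_segment t (x z : U) : 0 < t -> t <= 1 -> Uad x -> Uad z ->
  Uad (t *: (z - x) + x) by exact: convex_set_segment.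
(* Both [ph] and [phat] lie in [W], so the discrete state equations turn [D] into [b], and the
   adjoint equations turn [b] into inner products. *)
have D_uh_hat : D (u - uh) ph - D (u - uh) phat <= 0.
  rewrite !DB -!sthat// -!sth// phTh /phat !adjhat// -phTh !adjh// /dual_op /riesz.
  have := sqr_ge0 `|O yhat - O yh|; rewrite -inner_sqr_norm.
  rewrite !linearBl !linearBr /= (innerC (O yh) (O yhat)).
  lra.
(* The control [uh] is admissible in the continuous problem once solvability supplies a state for
   it. *)
have vi : 0 <= D uh p - D u p + alpha * inner u (uh - u).
  have [yuh yuhP] :=
    @state_solvable _ _ _ b Mb Cb Mb0 bM Cb0 bis (D uh) bnd (Db uh).
  apply: (@variational_inequality _ _ _ _ _ b O D yd alpha Ol Dl setT setT Uad
    y u p yuh uh) => //.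
pose I := inf [set inner (riesz_inv (dual_op_to_dual D ph) + alpha *: uh)
  (wh - u) | wh in Uh `&` Uad].
rewrite -/I.
have key wh : (Uh `&` Uad) wh ->
  alpha ^+ 2 * `|u - uh| ^+ 2 - 6 * G ^+ 6 * (By + Bp + Bl) <=
  2 * (alpha * inner (riesz_inv (dual_op_to_dual D ph) + alpha *: uh) (wh - u)).
  move=> [Uhw Uaw].
  have vih : 0 <= D wh ph - D uh ph + alpha * inner uh (wh - uh).
    have [ywh Yywh ywhP] : exists2 z, Yh z & forall v, W v -> b z v = D wh v.
      apply: (@discrete_state_solvable _ _ _ b Cb Cb0 bis Yh Vh CPi Pi) => //.
      by case: (Db wh).
    apply: (@variational_inequality _ _ _ _ _ b O D yd alpha Ol Dl Yh W (Uh `&` Uad)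
      yh uh ph ywh wh) => //.
    move=> t x z t0 t1 [Uhx Uax] [Uhz Uaz]; split; last exact: Uad_segment.
    by case: Uhl (linear_subspaceB _ z x Uhl Uhz Uhx) => _ H Uzx; exact: H.
  have rz v : inner (riesz_inv (dual_op_to_dual D ph)) v = D v ph.
    apply: riesz_invK; split; first by move=> c v1 v2; rewrite /dual_op_to_dual Dl.
    by exists (MD * `|ph|) => v1; rewrite /dual_op_to_dual mulrAC.
  rewrite innerDl innerZl rz DB.
  have Dp : D (u - uh) phat - D (u - uh) p <= MD * `|u - uh| * `|p - phat|.
    have -> : D (u - uh) phat - D (u - uh) p = D (u - uh) (phat - p).
      have [dl _] := Db (u - uh).
      by rewrite [phat - p]addrC -[- p]scaleN1r dl /=; ring.
    by rewrite (distrC p) (le_trans (ler_norm _)).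
  (* The weight puts [alpha] entirely on [u - uh], leaving half of [alpha ^+ 2 * |u - uh| ^+ 2] on
     the left-hand side. *)
  have young : alpha * (MD * `|u - uh| * `|p - phat|) <=
    2^-1 * alpha ^+ 2 * `|u - uh| ^+ 2 + 2^-1 * MD ^+ 2 * `|p - phat| ^+ 2.
    by have := sqr_ge0 (alpha * `|u - uh| - MD * `|p - phat|); lra.
  have MDG : MD ^+ 2 * `|p - phat| ^+ 2 <= G ^+ 2 * `|p - phat| ^+ 2.
    by rewrite ler_wpM2r ?sqr_ge0// lerXn2r ?nnegrE// /G; lra.
  have GB : G ^+ 2 * `|p - phat| ^+ 2 <= 6 * G ^+ 6 * (By + Bp + Bl).
    have := ler_wpM2l (sqr_ge0 G) pphat.
    have : 3 * G ^+ 4 * `|y - yhat| ^+ 2 <= 3 * G ^+ 4 * (2 * G ^+ 2 * By).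
      by rewrite ler_wpM2l ?mulr_ge0 ?exprn_ge0.
    have := ler_wpM2r (addr_ge0 Bp0 Bl0) G42.
    have : 0 <= G ^+ 6 * (Bp + Bl) by rewrite mulr_ge0 ?addr_ge0 ?exprn_ge0.
    by lra.
  (* The sum of [vi] and [vih]: the inner products combine to [inner uh (wh - u) - |u - uh| ^+ 2],
     and [D_uh_hat] replaces [ph] by [phat] in the term with [u - uh]. *)
  have main : alpha * `|u - uh| ^+ 2 <= D wh ph - D u ph +
      alpha * inner uh (wh - u) + (D (u - uh) phat - D (u - uh) p).
    move: vi vih D_uh_hat; rewrite -(inner_sqr_norm (u - uh)) !DB.
    by rewrite !linearBl !linearBr /= (innerC uh u); lra.
  have := ler_wpM2l (ltW a0) main.
  have := ler_wpM2l (ltW a0) Dp.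
  by lra.
(* Dividing [key] by [2 * alpha] gives a lower bound of the set, hence of its infimum, the set being
   nonempty. *)
have : (alpha ^+ 2 * `|u - uh| ^+ 2 - 6 * G ^+ 6 * (By + Bp + Bl)) /
    (2 * alpha) <= I.
  apply: lb_le_inf => [|_ [wh Uw <-]].
    case: UhU0 => wh Uw.
    by exists (inner (riesz_inv (dual_op_to_dual D ph) + alpha *: uh) (wh - u)), wh.
  by rewrite ler_pdivrMr ?mulr_gt0//; have := key wh Uw; lra.
by rewrite ler_pdivrMr ?mulr_gt0//; lra.
Qed.
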